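(* Let $I_{\mathrm{MLD}}=(\bar H,\bar s,\bar t)$ be an MLD instance with complexity parameters $(n,m)$ and let $\alpha_{n,m}:\mathrm{MLD}\to\mathrm{MQ}$ be defined by $\alpha_{n,m}(\bar H,\bar s,\bar t)=\mathtt{pcce}_{n,m}(\bar H,\bar s,\bar t)\cup\mathtt{hwce}_{n,m}(\bar H,\bar s,\bar t)\cup\mathtt{wce}_{n,m}(\bar H,\bar s,\bar t)$, where the three systems are those defined in the context. If $\bar u$ is a witness of $\alpha_{n,m}(I_{\mathrm{MLD}})$, then it is also a witness of $I_{\mathrm{MLD}}$; here, the variables being ordered so that the first $n$ are $v_1,\dots,v_n$, this means that the vector $\bar v=(\bar v_1,\dots,\bar v_n)$ of the first $n$ entries of $\bar u$ satisfies $\bar H\bar v^\top=\bar s^\top$ and $\mathrm{w}(\bar v)\le\bar t$.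
   Context: $\mathbb{F}=\mathbb{F}_2$; $\mathrm{w}$ is the Hamming weight. An MLD instance with complexity parameters $(n,m)$ is a triple $(\bar H,\bar s,\bar t)$ with $\bar H=[\bar h_{i,j}]\in\mathbb{F}^{m\times n}$, $\bar s\in\mathbb{F}^m$ and $\bar t\le n$ a positive integer; a witness is a vector $v\in\mathbb{F}^n$ with $\bar Hv^\top=\bar s^\top$ and $\mathrm{w}(v)\le\bar t$. An MQ instance is a system of polynomial equations of degree at most 2 over $\mathbb{F}$; a witness is a common zero over $\mathbb{F}$. Let $\ell=\lfloor\log_2 n\rfloor+1$; $\bar t$ is also written in binary as $(\bar t_1,\dots,\bar t_\ell)\in\mathbb{F}^\ell$, with $\bar t=\sum_j\bar t_j2^{j-1}$. Quadratization: given a polynomial equation $f=0$ over $\mathbb{F}$, for each monomial $x_{i_1}x_{i_2}\cdots x_{i_d}$ of $f$ of degree $d\ge3$ introduce $d-2$ new variables $y_1,\dots,y_{d-2}$ with the equations $y_1=x_{i_1}x_{i_2}$, $y_2=y_1x_{i_3}$, ..., $y_{d-2}=y_{d-3}x_{i_{d-1}}$, and rewrite the monomial in $f$ as $y_{d-2}x_{i_d}$. The resulting system of equations of degree at most 2 (including the rewritten $f=0$) is $\mathtt{quadr}(f)$; for a system $S$, $\mathtt{quadr}(S)=\bigcup_{f\in S}\mathtt{quadr}(f)$. The following three systems depend only on $n$ and $m$; the entries $h_{i,j}$ of $H$, $s_i$ of $s$ and the bits $t_1,\dots,t_\ell$ of $t$ are variables in them. For an instance, $\mathtt{pcce}_{n,m}(\bar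 H,\bar s,\bar t)$, $\mathtt{hwce}_{n,m}(\bar H,\bar s,\bar t)$, $\mathtt{wce}_{n,m}(\bar H,\bar s,\bar t)$ denote the systems obtained by evaluating these variables at $\bar H,\bar s,(\bar t_1,\dots,\bar t_\ell)$. - Parity-check encoding: $\mathtt{pcce}_{n,m}=\{\sum_{j=1}^n h_{i,j}v_j+s_i=0\}_{i=1,\dots,m}$. - Weight-computation encoding: $\mathtt{hwce}_{n,m}=\mathtt{quadr}\Big(\Big\{a^{(i)}_j=a^{(i-1)}_j+\Big(\prod_{h=1}^{j-1}a^{(i-1)}_h\Big)v_i\Big\}_{i=1,\dots,n,\ j=1,\dots,\ell}\Big)$, with variables $v_i$ and $a^{(i)}_j$, and with $a^{(0)}_j=0$ for all $j$. - Weight-constraint encoding: $\mathtt{wce}_{n,m}=\mathtt{quadr}(\{F_\ell\})$, i.e. $\mathtt{quadr}$ applied to the equation $F_\ell=0$, where $F_\ell=\sum_{j=1}^{\ell}\Big[(a^{(n)}_j+t_j)\prod_{h=j+1}^{\ell}(a^{(n)}_h+t_h+1)\Big](t_j+1)\in\mathbb{F}[a^{(n)}_1,\dots,a^{(n)}_\ell,t_1,\dots,t_\ell]$. *)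

(* Defs.v *)
From mathcomp Require Import all_boot all_order all_algebra.
From mathcomp Require Export mpoly.

Set Implicit Arguments.
Unset Strict Implicit.
Unset Printing Implicit Defensive.

Import GRing.Theory.
Local Open Scope ring_scope.

Definition hweight n (v : 'rV['F_2]_n) : nat := #|[set i | v 0 i != 0]|.

Record MLD (n m : nat) := MkMLD {
  mld_H : 'M['F_2]_(m, n);
  mld_s : 'rV['F_2]_m;
  mld_t : nat;
  mld_t_gt0 : (0 < mld_t)%N;
  mld_t_le : (mld_t <= n)%N
}.

Definition mld_witness n m (I : MLD n m) (v : 'rV['F_2]_n) : Prop :=
  mld_H I *m v^T = (mld_s I)^T /\ (hweight v <= mld_t I)%N.

(* A polynomial p stands for the equation p = 0; msize is the total degree  *)
(* plus one.                                                                *)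
Definition quadratic N (p : {mpoly 'F_2[N]}) : bool := (msize p <= 3)%N.

Record MQ := MkMQ {
  mq_nvars : nat;
  mq_system : seq {mpoly 'F_2[mq_nvars]};
  mq_quadratic : all (@quadratic mq_nvars) mq_system
}.

Definition mq_witness (Q : MQ) (u : 'rV['F_2]_(mq_nvars Q)) : Prop :=
  forall f, f \in mq_system Q -> f.@[fun i => u 0 i] = 0.

Arguments mq_witness : clear implicits.

(* Polynomials whose variables are the elements of a finite type V, ordered *)
(* as in [enum V].                                                          *)
Notation poly_on V := {mpoly 'F_2[#|{: V}|]}.

Definition pvar (V : finType) (x : V) : poly_on V := 'X_(enum_rank x).

Definition psubst (V W : finType) (sigma : V -> poly_on W) (p : poly_on V) :
    poly_on W :=
  mmap (@mpolyC #|{: W}| 'F_2) (fun i => sigma (enum_val i)) p.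

Definition prename (V W : finType) (g : V -> W) : poly_on V -> poly_on W :=
  psubst (fun x => pvar (g x)).

Section Quadratization.
Variable V : finType.
Implicit Types (f : poly_on V) (m : 'X_{1..#|{: V}|}) (S : seq (poly_on V)).

(* The factors x_{i_1}, ..., x_{i_d} of a monomial, listed in the order of  *)
(* the variables and repeated according to multiplicity.                    *)
Definition factors m : seq 'I_#|{: V}| :=
  flatten [seq nseq (m i) i | i <- enum 'I_#|{: V}|].

Definition monom f (k : 'I_(size (msupp f))) : 'X_{1..#|{: V}|} :=
  tnth (in_tuple (msupp f)) k.

(* One new variable for each monomial of f and each r < d - 2, where d is   *)
(* the degree of the monomial (truncated subtraction: none if d <= 2).      *)
Definition newvar f : finType :=
  {k : 'I_(size (msupp f)) & 'I_(mdeg (monom k) - 2)}.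

Section OnePolynomial.
Variables (f : poly_on V) (k : 'I_(size (msupp f))).

Local Notation d := (mdeg (monom k)).

(* The r-th factor of the k-th monomial, r being counted from 0 and smaller *)
(* than d wherever this is used.                                            *)
Definition xfac (r : nat) : poly_on (V + newvar f) :=
  if onth (factors (monom k)) r is Some i then pvar (inl (enum_val i)) else 0.

Definition yvar (r : 'I_(d - 2)) : poly_on (V + newvar f) :=
  pvar (inr (Tagged (fun k : 'I_(size (msupp f)) => 'I_(mdeg (monom k) - 2)) r)).

(* [yvar r] is y_{r+1}; [ord_pred r] is r - 1 when r > 0. *)
Definition chain_eq (r : 'I_(d - 2)) : poly_on (V + newvar f) :=
  yvar r - (if r == 0%N :> nat then xfac 0 else yvar (ord_pred r)) * xfac r.+1.

(* The index d - 3 of y_{d-2} lies in 'I_(d - 2) exactly when d >= 3. *)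
Definition quad_monom : poly_on (V + newvar f) :=
  if insub (d - 3)%N is Some r then yvar r * xfac d.-1
  else prename inl 'X_[monom k].

End OnePolynomial.

Definition rewritten f : poly_on (V + newvar f) :=
  \sum_(k < size (msupp f)) f@_(monom k) *: quad_monom k.

Definition quadr f : seq (poly_on (V + newvar f)) :=
  rewritten f ::
  flatten [seq [seq chain_eq r | r <- enum 'I_(mdeg (monom k) - 2)]
          | k <- enum 'I_(size (msupp f))].

(* The new variables of distinct members of a system are kept distinct. *)
Definition newvars S : finType :=
  {i : 'I_(size S) & newvar (tnth (in_tuple S) i)}.

Definition quadrs S : seq (poly_on (V + newvars S)) :=
  flatten
    [seq [seq prename
                (fun x : V + newvar (tnth (in_tuple S) i) =>
                   match x return (V + newvars S)%type with
                   | inl x => inl x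
                   | inr y =>
                       inr (Tagged (fun i => newvar (tnth (in_tuple S) i)) y)
                   end) q
         | q <- quadr (tnth (in_tuple S) i)]
    | i <- enum 'I_(size S)].

End Quadratization.

Definition ell (n : nat) : nat := (trunc_log 2 n).+1.

(* v_i and a^(i)_j, i >= 1; indices start from 0, so that inr (i, j) is      *)
(* a^(i+1)_(j+1) in the 1-based notation.                                   *)
Definition unknown (n : nat) : finType := ('I_n + 'I_n * 'I_(ell n))%type.

(* h_{i,j}, s_i and t_j *)
Definition param (n m : nat) : finType :=
  ('I_m * 'I_n + 'I_m + 'I_(ell n))%type.

Definition basevar (n m : nat) : finType := (unknown n + param n m)%type.

Section Encodings.
Variables n m : nat.

Definition Xv (i : 'I_n) : poly_on (basevar n m) := pvar (inl (inl i)).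
Definition Xa (i : 'I_n) (j : 'I_(ell n)) : poly_on (basevar n m) :=
  pvar (inl (inr (i, j))).
Definition Xh (i : 'I_m) (j : 'I_n) : poly_on (basevar n m) :=
  pvar (inr (inl (inl (i, j)))).
Definition Xs (i : 'I_m) : poly_on (basevar n m) := pvar (inr (inl (inr i))).
Definition Xt (j : 'I_(ell n)) : poly_on (basevar n m) := pvar (inr (inr j)).

(* a^(k)_j for k <= n; a^(0)_j is the constant 0, not a variable. *)
Definition acc (k : nat) (j : 'I_(ell n)) : poly_on (basevar n m) :=
  if k is k'.+1 then (if insub k' is Some i then Xa i j else 0) else 0.

Definition pcce : seq (poly_on (basevar n m)) :=
  [seq \sum_(j < n) Xh i j * Xv j + Xs i | i <- enum 'I_m].

Definition hwce_eqs : seq (poly_on (basevar n m)) :=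
  [seq acc i.+1 j
         - (acc i j + (\prod_(h < ell n | (h < j)%N) acc i h) * Xv i)
  | i : 'I_n <- enum 'I_n, j : 'I_(ell n) <- enum 'I_(ell n)].

Definition hwce : seq (poly_on (basevar n m + newvars hwce_eqs)) :=
  quadrs hwce_eqs.

Definition F_ell : poly_on (basevar n m) :=
  \sum_(j < ell n)
    ((acc n j + Xt j)
       * \prod_(h < ell n | (j < h)%N) (acc n h + Xt h + 1)) * (Xt j + 1).

Definition wce : seq (poly_on (basevar n m + newvars [:: F_ell])) :=
  quadrs [:: F_ell].

End Encodings.

(* Binary digits, least significant first. *)
Definition tbit (t j : nat) : bool := odd (t %/ 2 ^ j).

Lemma tbit_sum n t : (t <= n)%N ->
  t = (\sum_(j < ell n) tbit t j * 2 ^ j)%N.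
Proof.
move=> le_tn; have: (t < 2 ^ ell n)%N.
  exact: leq_ltn_trans le_tn (trunc_log_ltn n (isT : (1 < 2)%N)).
elim: (ell n) t {le_tn} => [|l IH] t; first by rewrite ltnS leqn0 big_ord0 => /eqP.
move=> lt_t; rewrite big_ord_recl /tbit divn1 muln1.
have /IH def_t2: (t./2 < 2 ^ l)%N by rewrite -divn2 ltn_divLR // -expnSr.
rewrite -{1}(odd_double_half t) {1}def_t2; congr addn.
rewrite -muln2 big_distrl; apply: eq_bigr => j _ /=.
by rewrite /tbit -divn2 -divnMA -expnS -mulnA -expnSr.
Qed.

Section Reduction.
Variables n m : nat.

Definition param_value (I : MLD n m) (p : param n m) : 'F_2 :=
  match p with
  | inl (inl (i, j)) => mld_H I i j
  | inl (inr i) => mld_s I 0 i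
  | inr j => (tbit (mld_t I) j)%:R
  end.

Definition base_value (Y : finType) (I : MLD n m) (x : basevar n m) :
    poly_on (unknown n + Y) :=
  match x with
  | inl z => pvar (inl z)
  | inr p => (param_value I p)%:MP
  end.

Definition new_hwce : finType := newvars (hwce_eqs n m).
Definition new_wce : finType := newvars [:: F_ell n m].

(* The variables of the final system, v_1, ..., v_n first. *)
Definition mqvar : finType := (unknown n + (new_hwce + new_wce))%type.

Definition pcce_at (I : MLD n m) : seq (poly_on mqvar) :=
  [seq psubst (base_value (new_hwce + new_wce)%type I) p | p <- pcce n m].

Definition hwce_at (I : MLD n m) : seq (poly_on mqvar) :=
  [seq psubst (fun x : basevar n m + new_hwce =>
                 match x with
                 | inl z => base_value (new_hwce + new_wce)%type I z
                 | inr y => pvar (inr (inl y))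
                 end) p | p <- hwce n m].

Definition wce_at (I : MLD n m) : seq (poly_on mqvar) :=
  [seq psubst (fun x : basevar n m + new_wce =>
                 match x with
                 | inl z => base_value (new_hwce + new_wce)%type I z
                 | inr y => pvar (inr (inr y))
                 end) p | p <- wce n m].

Definition alpha_system (I : MLD n m) : seq (poly_on mqvar) :=
  pcce_at I ++ hwce_at I ++ wce_at I.

End Reduction.

Section Degrees.

Lemma msize_pvar (V : finType) (x : V) : msize (pvar x) = 2.
Proof. by rewrite /pvar msizeX mdeg1. Qed.

Lemma msizeM_le_add N (p q : {mpoly 'F_2[N]}) a b :
  (msize p <= a.+1)%N -> (msize q <= b.+1)%N -> (msize (p * q) <= (a + b).+1)%N.
Proof.
have [->|p0] := eqVneq p 0; first by rewrite mul0r mmeasure0.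
have [->|q0] := eqVneq q 0; first by rewrite mulr0 mmeasure0.
move=> lep leq_; rewrite msizeM //.
by have := leq_add lep leq_; rewrite addSn addnS; case: (msize p + _)%N.
Qed.

Lemma msizeX_le_mul N (p : {mpoly 'F_2[N]}) a :
  (msize p <= 2)%N -> (msize (p ^+ a) <= a.+1)%N.
Proof.
move=> lep; elim: a => [|a IH]; first by rewrite expr0 msize1.
by rewrite exprS; apply: (@msizeM_le_add _ _ _ 1 a).
Qed.

Lemma msize_sum_le N (T : Type) (r : seq T) (P : pred T)
    (F : T -> {mpoly 'F_2[N]}) b :
  (forall x, P x -> (msize (F x) <= b)%N) ->
  (msize (\sum_(x <- r | P x) F x) <= b)%N.
Proof.
move=> le; elim/big_ind: _ => //; first by rewrite mmeasure0.
by move=> x y lx ly; apply: leq_trans (mmeasureD_le _ _ _) _; rewrite geq_max lx.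
Qed.

Lemma msize_psubst (V W : finType) (sigma : V -> poly_on W) p :
  (forall x, (msize (sigma x) <= 2)%N) -> (msize (psubst sigma p) <= msize p)%N.
Proof.
move=> le; rewrite /psubst /mmap big_seq; apply: msize_sum_le => m' m'p.
have lem: (msize (mmap1 (fun i => sigma (enum_val i)) m') <= (mdeg m').+1)%N.
  rewrite /mmap1 mdegE; elim/big_rec2: _ => [|i d q _ IH]; first by rewrite msize1.
  by apply: msizeM_le_add => //; apply: msizeX_le_mul.
rewrite mul_mpolyC; apply: leq_trans (msizeZ_le _ _) _.
exact: leq_trans lem (msize_mdeg_lt m'p).
Qed.

Lemma quadr_quadratic (V : finType) (f : poly_on V) :
  all (@quadratic _) (quadr f).
Proof.
have xle k r : (msize (@xfac V f k r) <= 2)%N.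
  by rewrite /xfac; case: onth => [i|]; rewrite ?msize_pvar ?mmeasure0.
have yle k (r : 'I_(mdeg (@monom V f k) - 2)) : (msize (yvar r) <= 2)%N.
  by rewrite msize_pvar.
apply/allP => q; rewrite inE => /predU1P[->|/flattenP[_ /mapP[k _ ->]]].
  apply: msize_sum_le => k _; apply: leq_trans (msizeZ_le _ _) _.
  rewrite /quad_monom; case: insubP => [r _ _|ge3].
    by apply: (@msizeM_le_add _ _ _ 1 1).
  apply: leq_trans (msize_psubst _ _) _ => [x|]; first by rewrite msize_pvar.
  rewrite msizeX ltnS leqNgt; apply: contra ge3 => gt2.
  by rewrite ltn_sub2l.
case/mapP=> r _ ->; apply: leq_trans (mmeasureD_le _ _ _) _.
rewrite mmeasureN geq_max (leq_trans (yle _ _)) //=.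
by apply: (@msizeM_le_add _ _ _ 1 1) => //; case: ifP.
Qed.

Lemma quadrs_quadratic (V : finType) (S : seq (poly_on V)) :
  all (@quadratic _) (quadrs S).
Proof.
apply/allP => p /flattenP[_ /mapP[i _ ->] /mapP[q q_in ->]].
apply: leq_trans (msize_psubst _ _) _ => [x|]; first by rewrite msize_pvar.
exact: (allP (quadr_quadratic _)).
Qed.

Lemma pcce_quadratic n m : all (@quadratic _) (pcce n m).
Proof.
apply/allP => p /mapP[i _ ->]; apply: leq_trans (mmeasureD_le _ _ _) _.
rewrite geq_max msize_pvar andbT; apply: msize_sum_le => j _.
by apply: (@msizeM_le_add _ _ _ 1 1); rewrite msize_pvar.
Qed.

Lemma alpha_quadratic n m (I : MLD n m) :
  all (@quadratic _) (alpha_system I).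
Proof.
have ble Y x : (msize (@base_value n m Y I x) <= 2)%N.
  by case: x => x; rewrite /= ?msize_pvar // mmeasureC; case: (_ != _).
rewrite !all_cat; apply/and3P; split; apply/allP => _ /mapP[p p_in ->];
  apply: leq_trans (msize_psubst _ _) _.
- exact: ble.
- exact: (allP (pcce_quadratic _ _)).
- by case=> x; [exact: ble | rewrite msize_pvar].
- exact: (allP (quadrs_quadratic _)).
- by case=> x; [exact: ble | rewrite msize_pvar].
- exact: (allP (quadrs_quadratic _)).
Qed.

End Degrees.

Definition alpha n m (I : MLD n m) : MQ := MkMQ (alpha_quadratic I).

Lemma alpha_nvars_ge n m (I : MLD n m) : (n <= mq_nvars (alpha I))%N.
Proof. by rewrite /= !card_sum card_ord -addnA leq_addr. Qed.

Lemma enum_rankE (T : finType) (x : T) : enum_rank x = index x (enum T) :> nat.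
Proof.
by rewrite -[in RHS](nth_enum_rank x x) index_uniq ?enum_uniq // -cardE ltn_ord.
Qed.

Lemma enum_rank_inl (A B : finType) (x : A) :
  enum_rank (inl x : A + B) = enum_rank x :> nat.
Proof.
rewrite !enum_rankE.
have -> : enum {: A + B} = map inl (enum A) ++ map inr (enum B).
  by rewrite !enumT [in LHS]unlock.
rewrite index_cat map_f ?mem_enum // index_map //.
by move=> ? ? [].
Qed.

(* The first n variables of [alpha I] are v_1, ..., v_n. *)
Lemma alpha_first_vars n m (I : MLD n m) (i : 'I_n) :
  widen_ord (alpha_nvars_ge I) i = enum_rank (inl (inl i) : mqvar n m).
Proof.
by apply: val_inj; rewrite /= !enum_rank_inl enum_rankE index_enum_ord.
Qed.

(* Main.v *)
Require Import Defs.
From mathcomp Require Import all_boot all_order all_algebra.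
Local Open Scope ring_scope.

Import GRing.Theory.

(** In a solution, the chain equations of [quadr f] force every y_r to be the
    product of the first r + 1 factors of its monomial, so the original equation
    f = 0 holds too.  The equations of [hwce] then say that a^(i) is a^(i-1)
    incremented by v_i in binary; no carry leaves the ell bits because
    n < 2 ^ ell, so a^(n) is the binary expansion of the weight of v.  Finally
    F_ell is nonzero exactly when t has a 0 at the highest position where a^(n)
    and t differ, i.e. when a^(n) > t. *)

(** * Evaluation of polynomials at assignments of named variables *)

Definition peval {V : finType} (w : V -> 'F_2) (p : poly_on V) : 'F_2 :=
  p.@[fun i => w (enum_val i)].

Lemma peval_pvar (V : finType) (w : V -> 'F_2) x : peval w (pvar x) = w x.
Proof. by rewrite /peval /pvar mevalXU enum_rankK. Qed.

Lemma eq_peval {V : finType} (w1 w2 : V -> 'F_2) :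
  w1 =1 w2 -> peval w1 =1 peval w2.
Proof. by move=> eq_w p; apply: meval_eq => i; rewrite eq_w. Qed.

Lemma peval_psubst (V W : finType) (sigma : V -> poly_on W) w p :
  peval w (psubst sigma p) = peval (fun x => peval w (sigma x)) p.
Proof.
rewrite /peval /psubst /mmap [RHS]mevalE rmorph_sum; apply: eq_bigr => m _.
rewrite rmorphM /= mevalC rmorph_prod /=; congr (_ * _).
by apply: eq_bigr => i _; rewrite rmorphXn.
Qed.

(** * Soundness of quadratization *)

Lemma size_factors {V : finType} (m : 'X_{1..#|{: V}|}) :
  size (factors m) = mdeg m.
Proof.
rewrite /factors size_flatten /shape -map_comp sumnE big_map big_enum /= mdegE.
by apply: eq_bigr => i _; rewrite size_nseq.
Qed.

Lemma prod_factors {V : finType} (m : 'X_{1..#|{: V}|}) (v : _ -> 'F_2) :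
  \prod_(i <- factors m) v i = \prod_i v i ^+ m i.
Proof.
rewrite /factors big_flatten big_map big_enum /=; apply: eq_bigr => i _.
by rewrite big_nseq -Monoid.iteropE.
Qed.

Section QuadratizationSound.
Context {V : finType} {f : poly_on V} (w : V + newvar f -> 'F_2).

Local Notation fval k :=
  [seq w (inl (enum_val i)) | i <- factors (monom k)].

Lemma peval_xfac (k : 'I_(size (msupp f))) r :
  peval w (xfac k r) = nth 0 (fval k) r.
Proof.
rewrite /xfac -odflt_onth onth_map.
by case: onth => [i|]; rewrite /= ?peval_pvar // /peval meval0.
Qed.

Hypothesis sol_w : forall q, q \in quadr f -> peval w q = 0.

(** By induction along the chain. Since [r] counts from 0, [yvar r] is y_{r+1}, which gathers r + 2
    factors. *)
Lemma peval_yvar (k : 'I_(size (msupp f))) (r : 'I_(mdeg (monom k) - 2)) :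
  peval w (yvar r) = \prod_(i < r.+2) nth 0 (fval k) i.
Proof.
have chain0 s : peval w (chain_eq (k := k) s) = 0.
  apply: sol_w; rewrite inE; apply/orP; right.
  by apply/flatten_mapP; exists k; rewrite ?mem_enum ?map_f ?mem_enum.
have def_y (s : 'I_(mdeg (monom k) - 2)) : peval w (yvar s) =
    peval w (if s == 0%N :> nat then xfac k 0 else yvar (ord_pred s)) *
    peval w (xfac k s.+1).
  have /eqP := chain0 s.
  by rewrite /chain_eq /peval mevalB mevalM subr_eq0 => /eqP.
case: r => r lt_r; elim: r lt_r => [|r IH] lt_r; rewrite def_y /= !peval_xfac.
  by rewrite 2!big_ord_recr big_ord0 /= mul1r.
(* [ord_pred] is cyclic, but an index of the form [r.+1] does not wrap around. *)
have -> : ord_pred (Ordinal lt_r) = Ordinal (ltnW lt_r).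
  by apply: val_inj; rewrite /= modnDr modn_small // ltnW.
by rewrite IH [RHS]big_ord_recr.
Qed.

(** A monomial of degree d >= 3 splits into its first d - 1 factors, gathered in y_{d-2}, and its
    last one; a monomial of lower degree is merely renamed. *)
Lemma peval_quad_monom (k : 'I_(size (msupp f))) :
  peval w (quad_monom k) = peval (w \o inl) 'X_[monom k].
Proof.
rewrite /quad_monom; case: insubP => [r _ def_r|_]; last first.
  by rewrite /prename peval_psubst; apply: eq_peval => x; rewrite peval_pvar.
(* Truncated subtraction is harmless here: r < d - 2 excludes d <= 2, so r = d - 3 determines d. *)
have def_d : mdeg (monom k) = r.+3.
  have := ltn_ord r.
  by rewrite def_r; case: (mdeg _) => [|[|[|d]]] //; rewrite !subSS !subn0.
rewrite /peval mevalM -!/(peval _ _) peval_yvar peval_xfac.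
have -> : (mdeg (monom k)).-1 = r.+2 by rewrite [in LHS]def_d.
rewrite -[LHS](big_ord_recr r.+2 (fun i : 'I__ => (fval k)`_i)) /=.
rewrite -def_d -size_factors.
rewrite /peval mevalX -prod_factors -[RHS](big_map _ predT idfun).
by rewrite (big_nth 0) (size_map _ (factors _)) big_mkord.
Qed.

Lemma quadr_sound : peval (w \o inl) f = 0.
Proof.
have /sol_w <- : rewritten f \in quadr f by rewrite inE eqxx.
rewrite /peval mevalE big_tnth rmorph_sum; apply: eq_bigr => k _ /=.
by rewrite mevalZ -/(peval _ _) peval_quad_monom /peval mevalX.
Qed.

End QuadratizationSound.

(** New variables are tagged by position in [S], so restricting [w] to those of one occurrence of
    [f] gives a solution of [quadr f]. *)
Lemma quadrs_sound {V : finType} {S : seq (poly_on V)} w f :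
    (forall q, q \in quadrs S -> peval w q = 0) ->
  f \in S -> peval (w \o inl) f = 0.
Proof.
move=> sol_w Sf; have lt_i : (index f S < size S)%N by rewrite index_mem.
pose i := Ordinal lt_i; have def_f : tnth (in_tuple S) i = f.
  by rewrite (tnth_nth 0) nth_index.
rewrite -def_f.
pose g (x : V + newvar (tnth (in_tuple S) i)) : (V + newvars S)%type :=
  match x with
  | inl x => inl x
  | inr y => inr (Tagged (fun i => newvar (tnth (in_tuple S) i)) y)
  end.
apply: (quadr_sound (w \o g)) => q q_in.
have /sol_w : prename g q \in quadrs S.
  by apply/flatten_mapP; exists i; rewrite ?mem_enum ?map_f.
by rewrite /prename peval_psubst => <-; apply: eq_peval => x; rewrite peval_pvar.
Qed.

(** * Binary increment and comparison over F_2 *)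

Lemma F2P (x : 'F_2) : x = (x != 0)%:R.
Proof. by case: x => [[|[|x]] lt_x] //; apply: val_inj. Qed.

Lemma F2D_neq0 (x y : 'F_2) : (x + y != 0) = (x != 0) (+) (y != 0).
Proof. by case: x y => [[|[|x]] lt_x] // [[|[|y]] lt_y]. Qed.

(** Digits are indexed by all of [nat], so that an induction on [l] can peel off the top digit
    without changing [a]. *)
Definition binval (l : nat) (a : nat -> 'F_2) : nat :=
  \sum_(j < l) (a j != 0%R) * 2 ^ j.

(** Ripple carry: the bit [x] is carried into position j only through lower digits that are all 1.
    Keeping the carry out of the top position in the equation makes the induction on [l] work. *)
Lemma binval_incr l (a b : nat -> 'F_2) x :
    (forall j, (j < l)%N -> b j = a j + (\prod_(h < j) a h) * x) ->
  (binval l b + ((\prod_(h < l) a h) * x != 0)%R * 2 ^ l =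
   binval l a + (x != 0)%R)%N.
Proof.
rewrite /binval; elim: l => [|l IH] def_b; first by rewrite !big_ord0 mul1r muln1.
rewrite !big_ord_recr /= [RHS]addnAC -IH => [|j lt_j]; last by rewrite def_b // ltnW.
rewrite def_b // mulrAC F2D_neq0 !mulf_eq0 expnS -!addnA; congr addn.
(* Half adder at position l, with incoming carry c: (a_l xor c) + 2 (a_l and c) = a_l + c. *)
by case: (a l == 0); case: (_ == 0); case: (_ == 0);
  rewrite /= ?mul1n ?mul0n ?addn0 // mul2n addnn.
Qed.

(** Peeling off the top digit writes the sum as F (a_l + t_l + 1) + (a_l + t_l)(t_l + 1), with F the
    sum for the lower digits. If the top digits agree, F vanishes and induction applies; if they
    differ, t_l = 1 and a_l = 0, which decides the comparison whatever the lower digits. *)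
Lemma binval_le l (a t : nat -> 'F_2) :
    \sum_(j < l) ((a j + t j) * \prod_(h < l | (j < h)%N) (a h + t h + 1))
      * (t j + 1) = 0 ->
  (binval l a <= binval l t)%N.
Proof.
have binval_lt k (c : nat -> 'F_2) : (binval k c < 2 ^ k)%N.
  rewrite /binval; elim: k => [|k IH]; first by rewrite big_ord0.
  rewrite big_ord_recr /= expnS mul2n -addnn -addSn leq_add //.
  by rewrite -[leqRHS]mul1n leq_mul // leq_b1.
elim: l => [|l IH]; first by rewrite /binval !big_ord0.
rewrite big_ord_recr /= [\prod_(h < _ | (l < h)%N) _]big1 => [|h]; last first.
  by rewrite ltnNge -ltnS ltn_ord.
(* Each lower summand contains the same factor for h = l, which is then pulled out of the sum. *)
under eq_bigr => j _
  do rewrite big_mkcond big_ord_recr /= ltn_ord mulrA mulrAC -big_mkcond.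
rewrite -mulr_suml /binval !big_ord_recr /= -!/(binval _ _) mulr1.
have := binval_lt l a; have := binval_lt l t; move: IH.
have bitE (b : bool) : (b%:R != 0 :> 'F_2) = b by case: b.
rewrite [a l]F2P [t l]F2P !bitE.
have F2_1D1 : 1 + 1 = 0 :> 'F_2 by apply: val_inj.
case: (a l != 0); case: (t l != 0) => /= IHl lt_t lt_a;
  rewrite ?F2_1D1 ?addr0 ?add0r ?mulr0 ?mul0r ?mulr1 ?addr0 ?add0r
          ?F2_1D1 ?mulr0 ?add0r ?mul1n ?mul0n ?addn0 //.
- by move/IHl; rewrite leq_add2r.
- by rewrite (leq_trans (ltnW lt_a)) ?leq_addl.
Qed.

(** * From a solution of the encoded system to the MLD conditions *)

Section WitnessOfSolution.
Context {n m : nat} {I : MLD n m} (w : mqvar n m -> 'F_2).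
Hypothesis sol_w : forall f, f \in alpha_system I -> peval w f = 0.

Local Notation v i := (w (inl (inl i))).

(** Giving the parameters their values in [I] lets the encodings be studied before the instance is
    substituted. *)
Definition base_assignment (x : basevar n m) : 'F_2 :=
  match x with
  | inl z => w (inl z)
  | inr p => param_value I p
  end.
Local Notation bval := (peval base_assignment).

Lemma peval_base_value x :
  peval w (base_value (new_hwce n m + new_wce n m)%type I x) =
  base_assignment x.
Proof. by case: x => x /=; rewrite ?peval_pvar // /peval mevalC. Qed.

Lemma pcce_sol f : f \in pcce n m -> bval f = 0.
Proof.
move=> f_in; rewrite -(eq_peval _ _ peval_base_value) -peval_psubst.
by apply: sol_w; rewrite !mem_cat map_f.
Qed.

(** Evaluating after substitution of the instance is evaluating at [w']; so [w'] solves [hwce], and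
    [quadrs_sound] discards the auxiliary variables. *)
Lemma hwce_sol f : f \in hwce_eqs n m -> bval f = 0.
Proof.
pose w' (x : basevar n m + new_hwce n m) : 'F_2 :=
  match x with
  | inl z => base_assignment z
  | inr y => w (inr (inl y))
  end.
apply: (quadrs_sound w') => q q_in.
have /sol_w <- : psubst (fun x : basevar n m + new_hwce n m =>
    match x with
    | inl z => base_value (new_hwce n m + new_wce n m)%type I z
    | inr y => pvar (inr (inl y))
    end) q \in alpha_system I.
  by rewrite !mem_cat map_f ?orbT.
rewrite peval_psubst; apply: eq_peval => -[x|y].
  by rewrite peval_base_value.
by rewrite peval_pvar.
Qed.

Lemma wce_sol : bval (F_ell n m) = 0.
Proof.
pose w' (x : basevar n m + new_wce n m) : 'F_2 :=
  match x with
  | inl z => base_assignment z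
  | inr y => w (inr (inr y))
  end.
apply: (quadrs_sound (S := [:: F_ell n m]) w'); last exact: mem_head.
move=> q q_in.
have /sol_w <- : psubst (fun x : basevar n m + new_wce n m =>
    match x with
    | inl z => base_value (new_hwce n m + new_wce n m)%type I z
    | inr y => pvar (inr (inr y))
    end) q \in alpha_system I.
  by rewrite !mem_cat map_f ?orbT.
rewrite peval_psubst; apply: eq_peval => -[x|y].
  by rewrite peval_base_value.
by rewrite peval_pvar.
Qed.

Lemma sol_syndrome i : \sum_j mld_H I i j * v j = mld_s I 0 i.
Proof.
have : \sum_(j < n) Xh i j * Xv m j + Xs n i \in pcce n m.
  by apply/mapP; exists i; rewrite ?mem_enum.
move/pcce_sol; rewrite /peval mevalD rmorph_sum -!/(peval _ _) /=.
rewrite peval_pvar /= => /eqP.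
rewrite addr_eq0 => /eqP; rewrite oppr_pchar2 // => <-.
by apply: eq_bigr => j _; rewrite mevalM -!/(peval _ _) !peval_pvar.
Qed.

(** [inord] makes the digits a total sequence, as [binval] expects; only positions below [ell n]
    matter. *)
Definition counter (k j : nat) : 'F_2 := bval (acc m k (inord j : 'I_(ell n))).

Lemma counter_step (i : 'I_n) j : (j < ell n)%N ->
  counter i.+1 j = counter i j + (\prod_(h < j) counter i h) * v i.
Proof.
move=> lt_j; pose jo : 'I_(ell n) := inord j.
have def_j : jo = j :> nat by rewrite inordK.
have : acc m i.+1 jo
    - (acc m i jo + (\prod_(h < ell n | (h < jo)%N) acc m i h) * Xv m i)
    \in hwce_eqs n m.
  by apply/allpairsP; exists (i, jo); rewrite !mem_enum.
move/hwce_sol; rewrite /peval mevalB mevalD mevalM rmorph_prod => /eqP.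
rewrite subr_eq0 -!/(peval _ _) => /eqP; rewrite peval_pvar => def_a.
rewrite [LHS]def_a.
congr (_ + _ * _); rewrite def_j (big_ord_widen _ (counter i) (ltnW lt_j)).
by apply: eq_bigr => h _; rewrite /counter inord_val.
Qed.

Lemma binval_counter k : (k <= n)%N ->
  binval (ell n) (counter k) = (\sum_(i < n | (i < k)%N) (v i != 0%R))%N.
Proof.
have lt_ell i : (i <= n)%N -> (i < 2 ^ ell n)%N.
  by move=> le_i; apply: leq_ltn_trans le_i (trunc_log_ltn _ _).
elim: k => [_|k IH lt_k].
  rewrite /binval !big1 // => j _.
  by rewrite /counter /acc /peval meval0 eqxx mul0n.
have sumS : (\sum_(i < n | (i < k.+1)%N) (v i != 0%R))%N =
    (\sum_(i < n | (i < k)%N) (v i != 0%R) + (v (Ordinal lt_k) != 0)%R)%N.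
  rewrite (bigD1 (Ordinal lt_k)) //= addnC; congr (_ + _)%N.
  by apply: eq_bigl => i; rewrite -val_eqE /= ltnS andbC -ltn_neqAle.
have := @binval_incr _ _ _ _ (counter_step (Ordinal lt_k)).
rewrite IH ?(ltnW lt_k) // -sumS => def_sum; rewrite -def_sum.
have : (\sum_(i < n | (i < k.+1)%N) (v i != 0%R) <= n)%N.
  apply: leq_trans (_ : \sum_(i < n) 1 <= n)%N; last first.
    by rewrite sum1_card card_ord.
  by rewrite big_mkcond leq_sum // => i _; case: ifP => // _; apply: leq_b1.
move/lt_ell; rewrite -def_sum.
(* A carry out of the top position would make a partial weight, which is at most n, reach 2 ^
   [ell n]. *)
by case: (_ != 0) => /=; rewrite ?mul1n ?addn0 // ltnNge leq_addl.
Qed.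

Lemma weight_le : (\sum_(i < n) (v i != 0%R) <= mld_t I)%N.
Proof.
have -> : (\sum_(i < n) (v i != 0%R))%N = binval (ell n) (counter n).
  by rewrite binval_counter //; apply: eq_bigl => i; rewrite ltn_ord.
pose tb j : 'F_2 := (tbit (mld_t I) j)%:R.
(* Since t <= n, the [ell n] digits represent t exactly. *)
have -> : mld_t I = binval (ell n) tb.
  rewrite {1}(tbit_sum (mld_t_le I)); apply: eq_bigr => j _.
  by rewrite /tb; case: tbit.
apply: binval_le; rewrite -[RHS]wce_sol /F_ell /peval rmorph_sum.
apply: eq_bigr => j _; rewrite /= !(mevalM, mevalD, meval1) rmorph_prod.
rewrite -!/(peval _ _) !peval_pvar /counter inord_val; congr (_ * _ * _).
apply: eq_bigr => h _; rewrite /= !mevalD meval1 -!/(peval _ _) peval_pvar.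
by rewrite /counter inord_val.
Qed.

End WitnessOfSolution.

Theorem theorem3p14 (n m : nat) (I : MLD n m)
    (u : 'rV['F_2]_(mq_nvars (alpha I))) :
  mq_witness (alpha I) u ->
  mld_witness I (\row_(j < n) u 0 (widen_ord (alpha_nvars_ge I) j)).
Proof.
(* The coordinates of [u] are numbered by [enum_rank]; [w] reads them by variable name. *)
move=> sol_u; pose w (x : mqvar n m) : 'F_2 := u 0 (enum_rank x).
have sol_w f : f \in alpha_system I -> peval w f = 0.
  by move/sol_u <-; apply: meval_eq => i; rewrite /w enum_valK.
have def_v j : u 0 (widen_ord (alpha_nvars_ge I) j) = w (inl (inl j)).
  by rewrite alpha_first_vars.
split.
  apply/colP => i; rewrite !mxE -(sol_syndrome w sol_w).
  by apply: eq_bigr => j _; rewrite !mxE def_v.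
apply: leq_trans (weight_le w sol_w); rewrite /hweight -sum1dep_card big_mkcond.
by apply: leq_sum => i _; rewrite mxE def_v; case: (_ != 0).
Qed.
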